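(* ($C$-equations) Let $(n,k,m)$ be a triplet of nonnegative integers with $k+m\le n$. Let $\mathcal{Z}$ be a real $n\times(k+m)$ matrix of rank $k+m$, let $C\in\mathrm{Gr}_{k,n}$ and let $Y\in\mathrm{Gr}_{k,k+m}$ be the point represented by $C\mathcal{Z}$. Then for every $A\in\binom{[n]}{k-1}$ and every $B\in\binom{[n]}{m-1}$, $$\sum_{i=1}^{n}p_{A,i}(C)\,\langle Y,B,i\rangle=0 .$$
   Context: $[n]=\{1,\dots,n\}$ and $\binom{[n]}{p}$ is the set of strictly increasing lists of $p$ elements of $[n]$ (empty if $p<0$). $\mathrm{Gr}_{k,n}$ is the real Grassmannian of $k$-planes in $\mathbb{R}^n$; a point is represented by a $k\times n$ matrix whose rows span it, still denoted $C$. For a list $L$ of $k$ elements of $[n]$, $p_L(C)$ is the determinant of the $k\times k$ matrix formed by the columns of $C$ indexed by $L$, in the order of $L$; $A,i$ denotes the list $A$ followed by $i$. It is understood that $C\mathcal{Z}$ has rank $k$, so that $Y$ is defined. If $Y$ is represented by a $k\times(k+m)$ matrix with rows $Y_1,\dots,Y_k$ and $\mathcal{Z}_1,\dots,\mathcal{Z}_n\in\mathbb{R}^{k+m}$ are the rows of $\mathcal{Z}$, then $\langle Y,i_1,\dots,i_m\rangle:=\det(Y_1,\dots,Y_k,\mathcal{Z}_{i_1},\dots,\mathcal{Z}_{i_m})$. Both $p$ and $\langle Y,\cdot\rangle$ depend on representatives only through a common nonzero factor, which does not affect the equation. *)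

(* Defs.v *)
From HB Require Import structures.
From mathcomp Require Import all_boot all_order all_algebra.
From mathcomp Require Import reals.

Set Implicit Arguments.
Unset Strict Implicit.
Unset Printing Implicit Defensive.

Import GRing.Theory.
Local Open Scope ring_scope.

(* [n] = {1, ..., n} is modelled by 'I_n, that is, shifted to {0, ..., n - 1}. *)

Record Grassmannian (R : realType) (k n : nat) := MkGrassmannian {
  gr_space :> {vspace 'rV[R]_n};
  gr_dim : \dim gr_space = k }.

(* As V has dimension k, a k x n matrix representing it has rank k. *)
Definition represents (R : realType) (k n : nat) (M : 'M[R]_(k, n))
    (V : Grassmannian R k n) : Prop :=
  <<[seq row i M | i : 'I_k]>>%VS = gr_space V.

Definition strictly_increasing (n p : nat) (L : p.-tuple 'I_n) : Prop :=
  sorted ltn [seq val i | i <- L].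

(* The list A,i of length p + 1 = k. The equation p + 1 = k encodes p = k - 1
   without truncated subtraction: it has no solution when k = 0. *)
Definition list_snoc (n p k : nat) (hp : p.+1 = k) (A : p.-tuple 'I_n)
    (i : 'I_n) : k.-tuple 'I_n :=
  tcast hp [tuple of rcons A i].

Definition plucker (R : realType) (k n : nat) (C : 'M[R]_(k, n))
    (L : k.-tuple 'I_n) : R :=
  \det (colsub (tnth L) C).

Definition twistor (R : realType) (n k m : nat) (Z : 'M[R]_(n, k + m))
    (Y : 'M[R]_(k, k + m)) (I : m.-tuple 'I_n) : R :=
  \det (col_mx Y (rowsub (tnth I) Z)).

(* Main.v *)
(* Only the last column of the minor p_{A,i}(C) and the last row of the
   determinant <Y,B,i> depend on i. Laplace expansion along them gives a row u
   and a column w, both independent of i, with p_{A,i}(C) = (u C)_i and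
   <Y,B,i> = (Z w)_i, so the sum equals u C Z w. It vanishes because w kills
   the rows of Y, hence their span, which contains the rows of C Z. *)

Require Import Defs.
From HB Require Import structures.
From mathcomp Require Import all_boot all_order all_algebra.
From mathcomp Require Import reals.

Set Implicit Arguments.
Unset Strict Implicit.
Unset Printing Implicit Defensive.

Import GRing.Theory.
Local Open Scope ring_scope.

(** The cofactors along row [r] involve only the other rows, which [N] shares with [M]; so column
    [r] of [\adj M] serves every such [N]. *)
Lemma det_row'E (R : comPzRingType) (n : nat) (r : 'I_n) (M N : 'M[R]_n) :
  row' r N = row' r M -> \det N = (row r N *m col r (\adj M)) 0 0.
Proof.
move=> eqNM; rewrite (expand_det_row N r) mxE; apply: eq_bigr => j _.
rewrite !mxE /cofactor; congr (_ * (_ * \det _)); apply/matrixP => a b.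
by move/matrixP: eqNM => /(_ a (lift j b)); rewrite !mxE.
Qed.

Lemma det_col'E (R : comPzRingType) (n : nat) (r : 'I_n) (M N : 'M[R]_n) :
  col' r N = col' r M -> \det N = (row r (\adj M) *m col r N) 0 0.
Proof.
move=> eqNM; rewrite (expand_det_col N r) mxE; apply: eq_bigr => j _.
by rewrite !mxE mulrC /cofactor eqNM.
Qed.

(** This is an off-diagonal entry of [M *m \adj M], a scalar matrix. *)
Lemma row_mul_col_adj (R : comPzRingType) (n : nat) (r s : 'I_n) (M : 'M[R]_n) :
  s != r -> row s M *m col r (\adj M) = 0.
Proof.
move=> sr; apply/matrixP => i j; rewrite !ord1.
transitivity ((M *m \adj M) s r).
  by rewrite !mxE; apply: eq_bigr => l _; rewrite !mxE.
by rewrite mul_mx_adj !mxE (negPf sr).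
Qed.

(** The kernel of right multiplication by [w] is a subspace, so generators suffice. *)
Lemma span_mulmx_eq0 (F : fieldType) (n p : nat) (s : seq 'rV[F]_n)
    (w : 'M[F]_(n, p)) (v : 'rV[F]_n) :
  {in s, forall x, x *m w = 0} -> v \in <<s>>%VS -> v *m w = 0.
Proof.
move=> sw0; suff /subvP sub : (<<s>> <= lker (linfun (mulmxr w)))%VS.
  by move=> /sub; rewrite memv_ker lfunE => /eqP.
by apply/span_subvP => x /sw0 xw0; rewrite memv_ker lfunE /= xw0.
Qed.

Lemma tnth_list_snoc_lift (n p : nat) (A : p.-tuple 'I_n) (i : 'I_n)
    (a : 'I_p) :
  tnth (list_snoc erefl A i) (lift ord_max a) = tnth A a.
Proof.
by rewrite /list_snoc tcast_id !(tnth_nth i) /= /bump leqNgt ltn_ord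
  nth_rcons size_tuple ltn_ord.
Qed.

Lemma tnth_list_snoc_max (n p : nat) (A : p.-tuple 'I_n) (i : 'I_n) :
  tnth (list_snoc erefl A i) ord_max = i.
Proof.
by rewrite /list_snoc tcast_id (tnth_nth i) /= nth_rcons size_tuple ltnn eqxx.
Qed.

Lemma plucker_snoc_linear (R : realType) (n p : nat) (C : 'M[R]_(p.+1, n))
    (A : p.-tuple 'I_n) :
  exists u : 'rV[R]_p.+1,
    forall i, plucker C (list_snoc erefl A i) = (u *m C) 0 i.
Proof.
(* The cofactors are read off at the reference index [ord0], which needs a nonempty index set;
   otherwise there is no [i] to check. *)
case: n C A => [|n] C A; first by exists 0 => -[].
pose M i := colsub (tnth (list_snoc erefl A i)) C.
exists (row ord_max (\adj (M ord0))) => i.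
rewrite /plucker (@det_col'E _ _ ord_max (M ord0)).
  rewrite !mxE; apply: eq_bigr => l _.
  by congr (_ * _); rewrite !mxE tnth_list_snoc_max.
by apply/matrixP => a b; rewrite !mxE !tnth_list_snoc_lift.
Qed.

Lemma twistor_snoc_linear (R : realType) (n k q : nat)
    (Z : 'M[R]_(n, k + q.+1)) (Y : 'M[R]_(k, k + q.+1)) (B : q.-tuple 'I_n) :
  exists2 w : 'cV[R]_(k + q.+1),
    forall j, row j Y *m w = 0 &
    forall i, twistor Z Y (list_snoc erefl B i) = (Z *m w) i 0.
Proof.
case: n Z B => [|n] Z B.
  by exists 0 => [j|[]//]; rewrite mulmx0.
pose M i := col_mx Y (rowsub (tnth (list_snoc erefl B i)) Z).
pose r : 'I_(k + q.+1) := rshift k ord_max.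
(* The cofactors of the last row [r]; each row of [Y] is another row of [M ord0], hence killed. *)
exists (col r (\adj (M ord0))) => [j|i].
  have -> : row j Y = row (lshift q.+1 j) (M ord0) by rewrite rowKu.
  by apply: row_mul_col_adj; rewrite eq_lrshift.
rewrite /twistor (@det_row'E _ _ r (M ord0)).
  rewrite !mxE; apply: eq_bigr => l _; congr (_ * _).
  by rewrite mxE col_mxEd mxE tnth_list_snoc_max.
apply/row_matrixP => a; rewrite row'Esub !row_rowsub.
(* A row other than [r] comes either from [Y] or from an entry of [B], and neither depends on
   [i]. *)
have := neq_lift r a; case: (split_ordP (lift r a)) => [b -> _|b -> rb].
  by rewrite !rowKu.
have [a' ->|bE] := unliftP ord_max b; last by rewrite bE eqxx in rb.
by rewrite !rowKd !row_rowsub !tnth_list_snoc_lift.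
Qed.

Theorem proposition3p1 (R : realType) (n k m : nat) (hkmn : (k + m <= n)%N)
  (Z : 'M[R]_(n, k + m)) (hZ : \rank Z = (k + m)%N)
  (C : Grassmannian R k n) (Y : Grassmannian R k (k + m))
  (Cmx : 'M[R]_(k, n)) (hC : represents Cmx C)
  (hY : represents (Cmx *m Z) Y)
  (Ymx : 'M[R]_(k, k + m)) (hYmx : represents Ymx Y)
  (p q : nat) (hp : p.+1 = k) (hq : q.+1 = m)
  (A : p.-tuple 'I_n) (hA : strictly_increasing A)
  (B : q.-tuple 'I_n) (hB : strictly_increasing B) :
  \sum_(i < n) plucker Cmx (list_snoc hp A i) * twistor Z Ymx (list_snoc hq B i)
  = 0.
Proof.
(* Turns [hp] and [hq] into [erefl], the form used in the lemmas. *)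
subst k m.
have [u uE] := plucker_snoc_linear Cmx A.
have [w Yw0 wE] := twistor_snoc_linear Z Ymx B.
transitivity ((u *m Cmx *m (Z *m w)) 0 0).
  by rewrite [RHS]mxE; apply: eq_bigr => i _; rewrite uE wE.
suff CZw0 : Cmx *m Z *m w = 0 by rewrite -mulmxA (mulmxA Cmx) CZw0 mulmx0 mxE.
apply/row_matrixP => j; rewrite row_mul row0.
(* [Ymx] and [Cmx *m Z] may differ as matrices; only their row spans agree. *)
apply: (@span_mulmx_eq0 _ _ _ [seq row i Ymx | i : 'I_p.+1]).
  by move=> _ /imageP[i _ ->].
by rewrite hYmx -hY memv_span // image_f.
Qed.
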